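(* Let $S\subseteq\mathbb{R}^s$ be an open set and let $f=(f_1,\dots,f_n):S\to\mathbb{R}^n$ be Fréchet differentiable on $S$. Then the following two statements are equivalent: (i) for every vector critical point $(x,\lambda)$ of $f$ (that is, every vector critical point $x\in S$ with a respective multiplier $\lambda$), the point $x$ is the unique global solution of the weighting problem $(\mathrm{P}_\lambda)$ with the same vector $\lambda$; (ii) $f$ is strictly invex on $S$.
   Context: For vectors $a,b\in\mathbb{R}^n$: $a<b$ means $a_i<b_i$ for all $i$, and $a\leqq b$ means $a_i\le b_i$ for all $i$; $a>b$ and $a\geqq b$ are defined analogously. The scalar product of $a$ and $b$ is written $a\,b$. The Jacobian matrix of $f$ at $x$ is $Jf(x)$, an $n\times s$ matrix with rows $\nabla f_i(x)$; for $\lambda\in\mathbb{R}^n$, $\lambda\,Jf(x)=\sum_{i=1}^n\lambda_i\nabla f_i(x)$, and $\lambda f(x)=\sum_{i=1}^n\lambda_i f_i(x)$. The vector problem (P) is: minimize $f(x)$ subject to $x\in S$. Vector critical point: a pair $(\bar x,\bar\lambda)\in S\times\mathbb{R}^n$ such that $\bar\lambda\geqq 0$, $\bar\lambda\neq 0$ and $\bar\lambda\,Jf(\bar x)=0$; $\bar\lambda$ is called a respective multiplier of $\bar x$. Weighting problem $(\mathrm{P}_\lambda)$, for $\lambda\geqq 0$, $\lambda\ne 0$: minimize $\lambda f(x)$ subject to $x\in S$. A point $\bar x\in S$ is its unique global solution if $\lambda f(\bar x)<\lambda f(x)$ for all $x\in S$, $x\neq\bar x$. Strictly invex: $f$ is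 strictly invex if for all $x,y\in S$ with $y\neq x$ there exists a vector $\eta(x,y)\in\mathbb{R}^s$ (depending on $x$ and $y$) such that $f(y)-f(x)>Jf(x)\,\eta(x,y)$ (componentwise strict inequality). *)

(* Defs.v *)
From HB Require Import structures.
From mathcomp Require Import all_boot all_order all_algebra.
From mathcomp Require Import all_classical all_reals all_analysis.
Set Implicit Arguments.
Unset Strict Implicit.
Unset Printing Implicit Defensive.
Import Order.TTheory GRing.Theory Num.Theory.
Import numFieldNormedType.Exports.
Local Open Scope classical_set_scope.
Local Open Scope ring_scope.

(* Vectors of R^n are row vectors. A map S -> R^n is represented by a total map *)
(* 'rV_s -> 'rV_n. The notions below only use its values on S and its Jacobian  *)
(* at points of S, which for S open is determined by the restriction to S.      *)

Definition vlt (R : realType) (n : nat) (a b : 'rV[R]_n) : Prop :=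
  forall i : 'I_n, a 0 i < b 0 i.

Definition vle (R : realType) (n : nat) (a b : 'rV[R]_n) : Prop :=
  forall i : 'I_n, a 0 i <= b 0 i.

Definition scalprod (R : realType) (n : nat) (a b : 'rV[R]_n) : R :=
  \sum_(i < n) a 0 i * b 0 i.

(* The library's 'J f x is the s x n matrix acting on row vectors on the right, *)
(* v *m 'J f x = 'd f x v. The usual Jacobian, whose rows are the gradients of  *)
(* the components of f, is its transpose.                                       *)
Definition Jmx (R : realType) (s n : nat) (f : 'rV[R]_s -> 'rV[R]_n)
    (x : 'rV[R]_s) : 'M[R]_(n, s) :=
  ('J f x)^T.

Definition vector_critical_point (R : realType) (s n : nat)
    (S : set 'rV[R]_s) (f : 'rV[R]_s -> 'rV[R]_n)
    (x : 'rV[R]_s) (lam : 'rV[R]_n) : Prop :=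
  [/\ S x, vle 0 lam, lam <> 0 & lam *m Jmx f x = 0].

Definition unique_global_solution (R : realType) (s : nat)
    (S : set 'rV[R]_s) (g : 'rV[R]_s -> R) (x : 'rV[R]_s) : Prop :=
  S x /\ forall y, S y -> y <> x -> g x < g y.

Definition weighted (R : realType) (s n : nat) (lam : 'rV[R]_n)
    (f : 'rV[R]_s -> 'rV[R]_n) : 'rV[R]_s -> R :=
  fun x => scalprod lam (f x).

(* The column vector Jf(x) eta is transposed to be compared with a row vector.  *)
Definition strictly_invex (R : realType) (s n : nat)
    (S : set 'rV[R]_s) (f : 'rV[R]_s -> 'rV[R]_n) : Prop :=
  forall x y : 'rV[R]_s, S x -> S y -> y <> x ->
  exists eta : 'cV[R]_s, vlt (Jmx f x *m eta)^T (f y - f x).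

(* Main.v *)
Require Import Defs.
From HB Require Import structures.
From mathcomp Require Import all_boot all_order all_algebra.
From mathcomp Require Import all_classical all_reals all_analysis.
From mathcomp Require Import lra.
Import Order.TTheory GRing.Theory Num.Theory.
Import numFieldNormedType.Exports.
Local Open Scope classical_set_scope.
Local Open Scope ring_scope.

(** Both statements are about a fixed pair of points [x <> y] of [S], through
    the matrix [A = Jf(x)] and the vector [c = f(y) - f(x)]. Strict invexity
    asks for a solution [eta] of the linear system [A eta < c]; the condition
    on critical points asks that every [lam >= 0], [lam <> 0] with
    [lam A = 0] satisfy [lam c > 0]. These are equivalent by a theorem of the
    alternative for strict linear inequalities ([strict_alternative]): if
    [A eta < c] is infeasible, then some nonnegative nonzero combination of
    its rows is the absurd inequality [0 < beta] with [beta <= 0].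

    The easy half is that a nonzero nonnegative combination of the strict
    inequalities [A eta < c] is a strict inequality ([scalprod_gt0]). The other
    half is Fourier-Motzkin elimination ([fourier_motzkin]), by induction on
    the number of unknowns. Instead of carrying multiplier vectors through the
    eliminations, the induction carries a set [K] of inequalities that contains
    the given ones and is closed under sums and positive multiples; the
    multipliers come back when [K] is taken to be the set of combinations of
    the rows of [A eta < c] with nonnegative, not all zero, coefficients. *)

Lemma seq_between (R : realFieldType) (L U : seq R) :
  (forall l u, l \in L -> u \in U -> l < u) ->
  exists t, (forall l, l \in L -> l < t) /\ (forall u, u \in U -> t < u).
Proof.
have above m : (forall u, u \in U -> m < u) ->
    exists2 t, m < t & forall u, u \in U -> t < u.
  elim: U => [_|u U IH mU]; first by exists (m + 1); rewrite ?ltrDl.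
  have [|t mt tU] := IH; first by move=> v vU; apply: mU; rewrite inE vU orbT.
  have mu : m < u by apply: mU; rewrite mem_head.
  exists (Num.min t ((m + u) / 2)); first by rewrite lt_min mt midf_lt.
  move=> v; rewrite inE gt_min => /orP[/eqP->|/tU->//].
  by rewrite (midf_lt mu) orbT.
have [m mU] : exists m, forall u, u \in U -> m < u.
  elim: U {above} => [|u U [m mU]]; first by exists 0.
  exists (Num.min m (u - 1)) => v; rewrite inE gt_min => /orP[/eqP->|/mU->//].
  by rewrite gtrBl ltr01 orbT.
elim: L => [_|l L IH LU]; first by exists m.
have [|t [Lt tU]] := IH.
  by move=> k u kL uU; apply: LU; rewrite // inE kL orbT.
have [|t' tt' t'U] := above (Num.max t l).
  by move=> u uU; rewrite gt_max tU // LU // mem_head.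
exists t'; split=> // k; move: tt'; rewrite gt_max inE => /andP[tt' lt'].
by case/orP=> [/eqP->//|/Lt/lt_trans]; apply.
Qed.

(** Eliminating the first unknown keeps the inequalities that do not involve it
    and adds, for each upper bound [p] and each lower bound [q] on it, the
    positive combination of [p] and [q] that cancels it. A solution of the
    reduced system extends because every lower bound is then below every upper
    bound. *)
Lemma fourier_motzkin (R : realFieldType) (s : nat)
    (K : 'rV[R]_s -> R -> Prop) (cs : seq ('rV[R]_s * R)) :
  (forall a b a' b', K a b -> K a' b' -> K (a + a') (b + b')) ->
  (forall k a b, 0 < k -> K a b -> K (k *: a) (k * b)) ->
  (forall p, p \in cs -> K p.1 p.2) ->
  (exists eta : 'cV[R]_s, forall p, p \in cs -> (p.1 *m eta) 0 0 < p.2) \/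
  (exists2 b, K 0 b & b <= 0).
Proof.
elim: s K cs => [|s IH] K cs KD KZ Kcs.
  (* Without unknowns, every inequality reads 0 < p.2. *)
  have [all_pos|] := boolP (all (fun p => 0 < p.2) cs).
    left; exists 0 => p /(allP all_pos); by rewrite mulmx0 mxE.
  rewrite -has_predC => /hasP[p p_cs /=]; rewrite -leNgt => p_le0; right.
  by exists p.2 => //; rewrite -(thinmx0 p.1); apply: Kcs.
pose c (p : 'rV[R]_(1 + s) * R) := p.1 0 0.
pose r (p : 'rV[R]_(1 + s) * R) : 'rV[R]_s := rsubmx p.1.
pose free := [seq (r p, p.2) | p <- cs & c p == 0].
pose crossed := [seq (c p *: r q - c q *: r p, c p * q.2 - c q * p.2)
  | p <- [seq p <- cs | 0 < c p], q <- [seq q <- cs | c q < 0]].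
have splitE (a : 'rV[R]_(1 + s)) : a = row_mx (a 0 0)%:M (rsubmx a).
  rewrite -[LHS]hsubmxK; congr row_mx.
  by rewrite [LHS]mx11_scalar !mxE; congr (a _ _)%:M; apply/val_inj.
(* K' is the trace of K on the inequalities without the first unknown: an
   absurd one found there is already one of K. *)
pose K' (a : 'rV[R]_s) b := K (row_mx (0 : 'M[R]_1) a : 'rV[R]_(1 + s)) b.
have [|||[eta eta_sol]|] := IH K' (free ++ crossed).
- move=> a b a' b' Ka Ka'; rewrite /K' -[X in row_mx X _](addr0 0) -add_row_mx.
  exact: KD.
- move=> k a b k0 Ka; rewrite /K' -[X in row_mx X _](scaler0 _ k) -scale_row_mx.
  exact: KZ.
- move=> p; rewrite mem_cat => /orP[/mapP[q]|/allpairsP[[u v] /= []]].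
    rewrite mem_filter => /andP[/eqP cq /Kcs Kq] -> /=.
    rewrite /K'; move: Kq; rewrite (splitE q.1) -/(c q) cq.
    by rewrite -[X in row_mx X _]scalemx1 scale0r.
  rewrite !mem_filter => /andP[cu /Kcs Ku] /andP[cv /Kcs Kv] -> /=.
  rewrite /K'.
  have -> : row_mx 0 (c u *: r v - c v *: r u)
      = c u *: v.1 + (- c v) *: u.1 :> 'rV[R]_(1 + s).
    rewrite (splitE v.1) (splitE u.1) -/(c u) -/(c v) -/(r u) -/(r v).
    rewrite !scale_row_mx add_row_mx !scale_scalar_mx -raddfD scaleNr /=.
    by rewrite mulNr [c v * _]mulrC subrr raddf0.
  by rewrite -mulNr; apply: KD; apply: KZ; rewrite ?oppr_gt0.
- left.
  (* Given eta for the other unknowns, p bounds the first one by bnd p, from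
     above or from below according to the sign of its coefficient c p. *)
  pose bnd p := (p.2 - (r p *m eta) 0 0) / c p.
  have [l u|t [lo up]] := @seq_between R
      [seq bnd q | q <- cs & c q < 0] [seq bnd p | p <- cs & 0 < c p].
    move=> /mapP[q q_cs ->] /mapP[p p_cs ->].
    have /eta_sol /= : (c p *: r q - c q *: r p, c p * q.2 - c q * p.2)
        \in free ++ crossed.
      by rewrite mem_cat; apply/orP; right; apply/allpairsP; exists (p, q).
    rewrite mulmxBl -!scalemxAl !mxE.
    move: q_cs p_cs; rewrite !mem_filter => /andP[cq _] /andP[cp _] lt_pq.
    rewrite /bnd ltr_pdivlMr // mulrAC ltr_ndivrMr //.
    by rewrite !mxE; move: lt_pq; lra.
  exists (col_mx t%:M eta : 'cV[R]_(1 + s)) => p p_cs.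
  rewrite (splitE p.1) (@mul_row_col _ 1 1 s) mxE -scalar_mxM -/(c p) -/(r p).
  rewrite [X in X + _]mxE eqxx mulr1n.
  have [cp|cp|cp] := ltrgtP (c p) 0.
  + have /lo : bnd p \in [seq bnd q | q <- cs & c q < 0].
      by apply: map_f; rewrite mem_filter cp.
    by rewrite /bnd ltr_ndivrMr //; lra.
  + have /up : bnd p \in [seq bnd p | p <- cs & 0 < c p].
      by apply: map_f; rewrite mem_filter cp.
    by rewrite /bnd ltr_pdivlMr //; lra.
  + rewrite cp mul0r add0r; apply: (eta_sol (r p, p.2)).
    rewrite mem_cat; apply/orP; left; apply/mapP; exists p => //.
    by rewrite mem_filter cp eqxx.
- by case=> b Kb b0; right; exists b => //; move: Kb; rewrite /K' row_mx0.
Qed.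

Lemma scalprodDl (R : realType) (n : nat) (a a' b : 'rV[R]_n) :
  scalprod (a + a') b = scalprod a b + scalprod a' b.
Proof.
by rewrite /scalprod -big_split; apply: eq_bigr => i _; rewrite mxE mulrDl.
Qed.

Lemma scalprodZl (R : realType) (n : nat) (k : R) (a b : 'rV[R]_n) :
  scalprod (k *: a) b = k * scalprod a b.
Proof.
by rewrite /scalprod mulr_sumr; apply: eq_bigr => i _; rewrite mxE mulrA.
Qed.

Lemma scalprodBr (R : realType) (n : nat) (a b b' : 'rV[R]_n) :
  scalprod a (b - b') = scalprod a b - scalprod a b'.
Proof.
by rewrite /scalprod -sumrB; apply: eq_bigr => i _; rewrite !mxE mulrBr.
Qed.

Lemma scalprod_mulmx (R : realType) (n : nat) (a : 'rV[R]_n) (v : 'cV[R]_n) :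
  scalprod a v^T = (a *m v) 0 0.
Proof. by rewrite mxE; apply: eq_bigr => i _; rewrite mxE. Qed.

Lemma scalprod_gt0 (R : realType) (n : nat) (lam d : 'rV[R]_n) :
  vle 0 lam -> lam <> 0 -> vlt 0 d -> 0 < scalprod lam d.
Proof.
move=> lam0 lamN0 d0.
have term_ge0 i : 0 <= lam 0 i * d 0 i.
  by have := lam0 i; have := d0 i; rewrite !mxE => /ltW ? ?; rewrite mulr_ge0.
rewrite lt_def sumr_ge0 // andbT; apply/eqP => sum0.
apply: lamN0; apply/rowP => i; rewrite mxE.
have /eqP := sum0; rewrite psumr_eq0 // => /allP /(_ i (mem_index_enum i)).
have := d0 i; rewrite mxE => di /=.
by rewrite mulf_eq0 (gt_eqF di) orbF => /eqP.
Qed.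

(** An inequality [0 < b], [b <= 0], reached by elimination is a combination
    of the rows whose coefficients form a multiplier [lam] violating the
    right-hand condition. Coefficients not all zero are stable under sums
    because they are nonnegative. *)
Lemma strict_alternative (R : realType) (s n : nat) (A : 'M[R]_(n, s))
    (c : 'rV[R]_n) :
  (exists eta : 'cV[R]_s, vlt (A *m eta)^T c) <->
  (forall lam : 'rV[R]_n,
     vle 0 lam -> lam <> 0 -> lam *m A = 0 -> 0 < scalprod lam c).
Proof.
split=> [[eta eta_lt] lam lam0 lamN0 lamA|no_cert].
  have : 0 < scalprod lam (c - (A *m eta)^T).
    by apply: scalprod_gt0 => // i; have := eta_lt i; rewrite !mxE subr_gt0.
  by rewrite scalprodBr scalprod_mulmx mulmxA lamA mul0mx mxE subr0.
pose K a b := exists lam : 'rV[R]_n,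
  [/\ vle 0 lam, lam <> 0, lam *m A = a & scalprod lam c = b].
have [||||] := @fourier_motzkin R s K [seq (row i A, c 0 i) | i <- enum 'I_n].
- move=> _ _ _ _ [l [l0 lN0 <- <-]] [m [m0 _ <- <-]].
  exists (l + m); split; last 2 first.
  + by rewrite mulmxDl.
  + by rewrite scalprodDl.
  + by move=> i; have := l0 i; have := m0 i; rewrite !mxE => ? ?; exact: addr_ge0.
  + move=> lm0; apply: lN0; apply/rowP => i; apply/eqP.
    have := l0 i; have := m0 i; rewrite !mxE => mi li.
    have /rowP/(_ i)/eqP := lm0; rewrite !mxE paddr_eq0 //.
    by case/andP.
- move=> k _ _ k0 [l [l0 lN0 <- <-]]; exists (k *: l); split.
  + by move=> i; have := l0 i; rewrite !mxE => li; rewrite mulr_ge0 // ltW.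
  + by move=> /eqP; rewrite scaler_eq0 gt_eqF //= => /eqP.
  + by rewrite scalemxAl.
  + by rewrite scalprodZl.
- move=> _ /mapP[i _ ->] /=; exists (delta_mx 0 i); split.
  + by move=> j; rewrite !mxE ler0n.
  + by move=> /rowP/(_ i)/eqP; rewrite !mxE !eqxx oner_eq0.
  + by rewrite rowE.
  + rewrite /scalprod (bigD1 i) //= mxE !eqxx mul1r big1 ?addr0 // => j ji.
    by rewrite mxE (negbTE ji) andbF mul0r.
- case=> eta sol; exists eta => i.
  have /sol /= : (row i A, c 0 i) \in [seq (row i A, c 0 i) | i <- enum 'I_n].
    by apply: map_f; rewrite mem_enum.
  by rewrite -row_mul !mxE.
- case=> b [lam [lam0 lamN0 lamA <-]].
  by rewrite leNgt no_cert.
Qed.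

Theorem theorem1 (R : realType) (s n : nat) (S : set 'rV[R]_s)
    (f : 'rV[R]_s -> 'rV[R]_n)
    (openS : open S)
    (diff_f : forall x : 'rV[R]_s, S x -> differentiable f x) :
  (forall (x : 'rV[R]_s) (lam : 'rV[R]_n),
     vector_critical_point S f x lam ->
     unique_global_solution S (weighted lam f) x)
  <-> strictly_invex S f.
Proof.
split=> [crit x y Sx Sy yx|invex x lam [Sx lam0 lamN0 lamJ]].
  apply/strict_alternative => lam lam0 lamN0 lamJ.
  have [] := crit x lam; first by split.
  by move=> _ /(_ y Sy yx); rewrite scalprodBr subr_gt0.
split=> // y Sy yx; rewrite /weighted -subr_gt0 -scalprodBr.
by have /strict_alternative := invex x y Sx Sy yx; apply.
Qed.
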